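(* Let $\mathbf W_t,\mathbf M_t\in\mathbb R^{n_t\times n_t}$ be the time matrices $$[\mathbf W_t]_{i,j}=\int_0^T b_j'(t)\,b_i(t)\,dt,\qquad [\mathbf M_t]_{i,j}=\int_0^T b_i(t)\,b_j(t)\,dt,$$ where $b_1,\dots,b_{n_t}$ are the B-spline basis functions on $(0,T)$ vanishing at $t=0$ described in the context, with $n_t\ge2$. Split $$\mathbf W_t=\begin{bmatrix}\mathring{\mathbf W}_t&\mathbf w\\-\mathbf w^T&\omega\end{bmatrix},\qquad \mathbf M_t=\begin{bmatrix}\mathring{\mathbf M}_t&\mathbf m\\\mathbf m^T&\mu\end{bmatrix},$$ with $\mathring{\mathbf W}_t,\mathring{\mathbf M}_t\in\mathbb R^{(n_t-1)\times(n_t-1)}$, $\mathbf w,\mathbf m\in\mathbb R^{n_t-1}$ and $\omega,\mu\in\mathbb R$. Then: 1. $\mathring{\mathbf W}_t$ is skew-symmetric, and there exist $\mathring{\mathbf U}_t\in\mathbb C^{(n_t-1)\times(n_t-1)}$ and a diagonal matrix $\mathring{\mathbf\Lambda}_t$ with purely imaginary (possibly zero) diagonal entries such that $$\mathring{\mathbf W}_t\mathring{\mathbf U}_t=\mathring{\mathbf M}_t\mathring{\mathbf U}_t\mathring{\mathbf\Lambda}_t,\qquad \mathring{\mathbf U}_t^*\mathring{\mathbf M}_t\mathring{\mathbf U}_t=\mathbb I_{n_t-1}.$$ 2. For any such $\mathring{\mathbf U}_t,\mathring{\mathbf\Lambda}_t$, let $\mathbf v$ be the solution of $\mathring{\mathbf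 M}_t\mathbf v=-\mathbf m$ and set $$\begin{bmatrix}\mathbf r\\\rho\end{bmatrix}=\left([\mathbf v^*\ 1]\,\mathbf M_t\begin{bmatrix}\mathbf v\\1\end{bmatrix}\right)^{-1/2}\begin{bmatrix}\mathbf v\\1\end{bmatrix},\qquad \mathbf U_t=\begin{bmatrix}\mathring{\mathbf U}_t&\mathbf r\\\mathbf 0^T&\rho\end{bmatrix}.$$ Then $$\mathbf U_t^*\mathbf M_t\mathbf U_t=\mathbb I_{n_t},\qquad \mathbf U_t^*\mathbf W_t\mathbf U_t=\mathbf\Delta_t:=\begin{bmatrix}\mathring{\mathbf\Lambda}_t&\mathbf g\\-\mathbf g^*&\sigma\end{bmatrix},$$ where $$\mathbf g=\mathring{\mathbf U}_t^*\,[\mathring{\mathbf W}_t\ \ \mathbf w]\begin{bmatrix}\mathbf r\\\rho\end{bmatrix},\qquad \sigma=[\mathbf r^*\ \rho^*]\,\mathbf W_t\begin{bmatrix}\mathbf r\\\rho\end{bmatrix}.$$ In particular $\mathbf W_t\mathbf U_t=\mathbf M_t\mathbf U_t\mathbf\Delta_t$ with $\mathbf\Delta_t$ an arrowhead matrix (nonzero entries only on the diagonal, in the last row and in the last column), and $\kappa_2(\mathbf U_t)=\sqrt{\kappa_2(\mathbf M_t)}$.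
   Context: **Time basis functions.** Let $T>0$, $p_t\ge1$, and let $\Xi_t=\{0=\xi_1\le\dots\le\xi_{m_t+p_t+1}=1\}$ be an open knot vector: $\xi_1=\dots=\xi_{p_t+1}=0$ and $\xi_{m_t+1}=\dots=\xi_{m_t+p_t+1}=1$. Let $\widehat b_{1,p_t},\dots,\widehat b_{m_t,p_t}$ be the associated B-splines of degree $p_t$ on $(0,1)$, given by the Cox–De Boor recursion: $\widehat b_{i,0}(\eta)=1$ if $\xi_i\le\eta<\xi_{i+1}$ and $0$ otherwise, and for $p\ge1$, $\widehat b_{i,p}(\eta)=\frac{\eta-\xi_i}{\xi_{i+p}-\xi_i}\widehat b_{i,p-1}(\eta)+\frac{\xi_{i+p+1}-\eta}{\xi_{i+p+1}-\xi_{i+1}}\widehat b_{i+1,p-1}(\eta)$ for $\xi_i\le\eta<\xi_{i+p+1}$ and $0$ otherwise (with $0/0=0$). Assume that the spline space $\mathrm{span}\{\widehat b_{i,p_t}\}_{i=1}^{m_t}$ is contained in $C^0((0,1))$; the functions are extended to $[0,1]$ by continuity. Set $n_t=m_t-1$ and $b_i(t)=\widehat b_{i+1,p_t}(t/T)$ for $i=1,\dots,n_t$ (the first B-spline is dropped, so that every $b_i$ vanishes at $t=0$). **Notation.** $\mathbf X^*$ is the conjugate transpose, $\mathbb I_n$ the $n\times n$ identity matrix, and $\kappa_2(\mathbf X)=\|\mathbf X\|_2\|\mathbf X^{-1}\|_2$ with $\|\cdot\|_2$ the matrix norm induced by the Euclidean vector norm. *)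

(* Defs.v *)
From HB Require Import structures.
From mathcomp Require Import all_boot all_order all_algebra spectral complex.
From mathcomp Require Import all_classical all_reals all_analysis.

Set Implicit Arguments.
Unset Strict Implicit.
Unset Printing Implicit Defensive.

Import Order.TTheory GRing.Theory Num.Theory.
Import numFieldNormedType.Exports.

Local Open Scope classical_set_scope.
Local Open Scope ring_scope.
Local Open Scope sesquilinear_scope.

(* Knots are indexed from 1: only xi 1, ..., xi (m + p + 1) are relevant, and
   the other values of xi : nat -> R are never used.  As usual for open knot
   vectors, the end knots have multiplicity exactly p + 1; a higher
   multiplicity would produce identically zero B-splines, and a second
   B-spline that does not vanish at 0. *)
Definition open_knot_vector (R : realType) (m p : nat) (xi : nat -> R) : Prop :=
  [/\ forall i, (1 <= i < m + p + 1)%N -> xi i <= xi i.+1,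
      forall i, (1 <= i <= m + p + 1)%N -> (xi i = 0 <-> (i <= p + 1)%N)
    & forall i, (1 <= i <= m + p + 1)%N -> (xi i = 1 <-> (m + 1 <= i)%N)].

(* Since x / 0 = 0 in a field, the convention 0 / 0 = 0 is built in; when a
   denominator vanishes, so does the B-spline of lower degree next to it. *)
Fixpoint bspline (R : realType) (xi : nat -> R) (p i : nat) (eta : R) : R :=
  match p with
  | 0%N => if xi i <= eta < xi i.+1 then 1 else 0
  | q.+1 =>
      if xi i <= eta < xi (i + p + 1)%N then
        (eta - xi i) / (xi (i + p)%N - xi i) * bspline xi q i eta
        + (xi (i + p + 1)%N - eta) / (xi (i + p + 1)%N - xi i.+1)
          * bspline xi q i.+1 eta
      else 0
  end.

Definition spline_space_C0 (R : realType) (m p : nat) (xi : nat -> R) : Prop :=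
  forall c : nat -> R,
    {in `]0, 1[, continuous
      (fun eta : R => \sum_(1 <= i < m.+1) c i * bspline xi p i eta)}.

(* Extension by continuity from ]0, 1[ to [0, 1]: the half-open convention of
   the recursion makes every B-spline vanish at 1. *)
Definition bspline_ext (R : realType) (xi : nat -> R) (p i : nat) (eta : R) : R :=
  if eta == 0 then lim (bspline xi p i x @[x --> 0^'+])
  else if eta == 1 then lim (bspline xi p i x @[x --> 1^'-])
  else bspline xi p i eta.

(* The i-th time basis function, i = 1, ..., m - 1. *)
Definition time_basis (R : realType) (T : R) (p : nat) (xi : nat -> R)
    (i : nat) (t : R) : R :=
  bspline_ext xi p i.+1 (t / T).

(* Row and column indices of matrices start at 0, basis functions at 1.  The
   derivatives exist off the finitely many points T * xi i. *)
Definition time_W (R : realType) (T : R) (p : nat) (xi : nat -> R) (n : nat) :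
    'M[R]_n :=
  \matrix_(i, j) \int[@lebesgue_measure R]_(t in `[0, T])
     (derive1 (time_basis T p xi j.+1) t * time_basis T p xi i.+1 t).

Definition time_M (R : realType) (T : R) (p : nat) (xi : nat -> R) (n : nat) :
    'M[R]_n :=
  \matrix_(i, j) \int[@lebesgue_measure R]_(t in `[0, T])
     (time_basis T p xi i.+1 t * time_basis T p xi j.+1 t).

Definition cplx_mx (R : realType) (m n : nat) (A : 'M[R]_(m, n)) : 'M[R[i]]_(m, n) :=
  map_mx (real_complex R) A.

Definition euclid_norm (R : realType) (n : nat) (x : 'cV[R[i]]_n) : R :=
  Num.sqrt (\sum_i Normc.normc (x i ord0) ^+ 2).

Definition norm2 (R : realType) (n : nat) (X : 'M[R[i]]_n) : R :=
  sup [set euclid_norm (X *m x) | x in [set x | euclid_norm x = 1]].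

Definition kappa2 (R : realType) (n : nat) (X : 'M[R[i]]_n) : R :=
  norm2 X * norm2 (invmx X).

Definition gen_eigendecomposition (R : realType) (n : nat)
    (W M U Lambda : 'M[R[i]]_n) : Prop :=
  [/\ is_diag_mx Lambda,
      forall i, complex.Re (Lambda i i) = 0,
      W *m U = M *m U *m Lambda
    & U ^t* *m M *m U = 1%:M].

Definition arrowhead (R : realType) (k : nat) (D : 'M[R[i]]_(k + 1)) : Prop :=
  forall i j : 'I_(k + 1),
    i != j -> (i < k)%N -> (j < k)%N -> D i j = 0.

(* Main.v *)
Require Import Defs.
From HB Require Import structures.
From mathcomp Require Import all_boot all_order all_algebra spectral complex.
From mathcomp Require Import all_classical all_reals all_analysis.
From mathcomp Require Import measurable_realfun pi_irrational.
From mathcomp Require Import ring lra zify.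

Set Implicit Arguments.
Unset Strict Implicit.
Unset Printing Implicit Defensive.

Import Order.TTheory GRing.Theory Num.Theory.
Import numFieldNormedType.Exports.

Local Open Scope classical_set_scope.
Local Open Scope ring_scope.
Local Open Scope sesquilinear_scope.

(* On each knot interval a B-spline is a polynomial, so every entry of W and M
   is a finite sum of integrals of polynomials.  Integrating (b_i b_j)' over
   the pieces telescopes, because the b_i are continuous, to b_i(T) b_j(T),
   which vanishes unless i = j = n_t: this is the block structure of W.

   M is a Gram matrix, so its definiteness is linear independence of the
   B-splines: those starting at a given knot vanish there to distinct orders,
   provided that no knot has multiplicity above p, and such a knot would make
   some B-spline discontinuous.

   The eigendecomposition comes from applying the spectral theorem twice, to M
   and then to the skew-Hermitian S^* W S, where S^* M S = 1.  Finally
   U^* M U = 1 gives M = (U^-1)^* U^-1 and M^-1 = U U^*, and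
   |A^* A| = |A|^2 = |A^*|^2 turns this into the identity between condition
   numbers. *)

(** * Integrals of polynomials *)

Section PolyIntegral.
Variable R : realType.
Implicit Types (p q : {poly R}) (a b : R).

(* The constant coefficient vanishes since x / 0 = 0. *)
Definition poly_prim p : {poly R} := \poly_(i < (size p).+1) (p`_i.-1 / i%:R).

(** An algebraic form of the integral over [[a, b]], so that linearity and signs are settled on
    polynomials; [integral_poly] links it to the Lebesgue integral. *)
Definition poly_int a b p := (poly_prim p).[b] - (poly_prim p).[a].

Lemma coef_poly_prim p i : (poly_prim p)`_i = p`_i.-1 / i%:R.
Proof.
rewrite coef_poly; case: ltnP => // h; rewrite nth_default ?mul0r //.
by case: i h => [|i] //=; rewrite ltnS => /ltnW.
Qed.

Lemma poly_prim_is_linear : linear poly_prim.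
Proof.
move=> c p q; apply/polyP => i.
by rewrite coefD coefZ !coef_poly_prim coefD coefZ mulrDl mulrA.
Qed.

HB.instance Definition _ := GRing.isLinear.Build R {poly R} {poly R} _ poly_prim
  poly_prim_is_linear.

Lemma deriv_poly_prim p : (poly_prim p)^`() = p.
Proof.
apply/polyP => i; rewrite coef_deriv coef_poly_prim /=.
by rewrite -[LHS]mulr_natr divfK // pnatr_eq0.
Qed.

Lemma poly_int_is_linear a b : linear (poly_int a b : {poly R} -> R^o).
Proof.
move=> c p q; rewrite /poly_int linearP /= !hornerD !hornerZ.
by rewrite /GRing.scale /=; ring.
Qed.

HB.instance Definition _ a b := GRing.isLinear.Build R {poly R} R^o _ (poly_int a b)
  (poly_int_is_linear a b).

Lemma poly_int_deriv a b p : poly_int a b p^`() = p.[b] - p.[a].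
Proof.
rewrite /poly_int; suff E : p = poly_prim p^`() + (p`_0)%:P.
  by rewrite [in RHS]E !hornerD !hornerC opprD addrACA subrr addr0.
apply/polyP => -[|i]; rewrite coefD coefC coef_poly_prim /=.
  by rewrite invr0 mulr0 add0r.
by rewrite addr0 coef_deriv -[X in X / _]mulr_natr mulfK // pnatr_eq0.
Qed.

Lemma horner_eq0_itv a b p : a < b -> {in `]a, b[, forall x, p.[x] = 0} -> p = 0.
Proof.
move=> ab h; apply/eqP/negPn/negP => p0.
(* These [size p] distinct points of the interval would all be roots, more than the degree
   allows. *)
pose s := [seq a + (b - a) / (i.+2)%:R | i <- iota 0 (size p)].
have := max_poly_roots p0 (rs := s); rewrite size_map size_iota ltnn => H.
have d0 : 0 < b - a by rewrite subr_gt0.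
apply/notF/H.
  apply/allP => _ /mapP [i _ ->]; apply/eqP/h; rewrite in_itv /=.
  rewrite ltrDl divr_gt0 ?ltr0n //= -ltrBrDl.
  by rewrite ltr_pdivrMr ?ltr0n // ltr_pMr // ltr1n.
rewrite map_inj_in_uniq ?iota_uniq // => i j _ _ /addrI /(mulfI (lt0r_neq0 d0)).
by move=> /invr_inj /eqP; rewrite eqr_nat => /eqP [].
Qed.

(** The mean value theorem for the primitive turns the integral into [b - a] times a value of [p]
    inside the interval. *)
Lemma poly_int_ge0 a b p : a <= b -> {in `]a, b[, forall x, 0 <= p.[x]} ->
  0 <= poly_int a b p.
Proof.
rewrite le_eqVlt => /predU1P[->|ab] h; first by rewrite /poly_int subrr.
have [c hc ->] : exists2 c, c \in `]a, b[%R & poly_int a b p = p.[c] * (b - a).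
  have [||c hc e] := @MVT R (horner (poly_prim p)) (horner p) a b ab.
  - move=> x _; rewrite -{2}(deriv_poly_prim p); exact: is_derive_poly.
  - by apply: continuous_subspaceT => x; exact: continuous_horner.
  - by exists c.
by rewrite mulr_ge0 ?h // subr_ge0 ltW.
Qed.

Lemma poly_int_sqr_ge0 a b p : a <= b -> 0 <= poly_int a b (p * p).
Proof. by move=> ab; apply: poly_int_ge0 => // x _; rewrite hornerM -expr2 sqr_ge0. Qed.

Lemma poly_int_sqr_eq0 a b p : a < b -> poly_int a b (p * p) = 0 -> p = 0.
Proof.
move=> ab e; suff : p * p = 0 by move/eqP; rewrite mulf_eq0 orbb => /eqP.
set q := p * p in e *.
have q0 x : 0 <= q.[x] by rewrite hornerM -expr2 sqr_ge0.
(* the primitive of q is monotone with equal values at both ends *)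
have : poly_prim q - ((poly_prim q).[a])%:P = 0.
  apply: (horner_eq0_itv ab) => x; rewrite in_itv /= => /andP[ax xb].
  rewrite hornerD hornerN hornerC; apply/eqP; rewrite eq_le.
  have := poly_int_ge0 (ltW ax) (fun y _ => q0 y).
  have := poly_int_ge0 (ltW xb) (fun y _ => q0 y).
  by move: e; rewrite /poly_int; lra.
by move/(congr1 (@deriv R)); rewrite derivB derivC subr0 deriv_poly_prim deriv0.
Qed.

Lemma integral_poly a b p : a <= b ->
  \int[@lebesgue_measure R]_(t in `[a, b]) p.[t] = poly_int a b p.
Proof.
rewrite le_eqVlt => /predU1P[->|ab].
  by rewrite set_itv1 Rintegral_set1 /poly_int subrr.
rewrite /Rintegral (@continuous_FTC2 _ _ (horner (poly_prim p))) //.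
- by apply: continuous_subspaceT => x; exact: continuous_horner.
- split; first by move=> x _; exact: derivable_horner.
  + by apply: cvg_at_right_filter; exact: continuous_horner.
  + by apply: cvg_at_left_filter; exact: continuous_horner.
- by move=> x _; rewrite -derivE deriv_poly_prim.
Qed.

Lemma integrable_poly a b p :
  (@lebesgue_measure R).-integrable `[a, b] (EFin \o horner p).
Proof.
apply: continuous_compact_integrable; first exact: segment_compact.
by apply: continuous_subspaceT => x; exact: continuous_horner.
Qed.

End PolyIntegral.

(** * Integrals of piecewise polynomial functions *)

Section PiecewiseIntegral.
Variable R : realType.
Local Notation leb := (@lebesgue_measure R).

(** The end points form a null set, so [h] is left free there; this is what lets derivatives be
    arbitrary at the knots. *)
Lemma integral_eq_poly_itvoo (a b : R) (h : R -> R) (p : {poly R}) : a <= b ->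
  {in `]a, b[, forall t, h t = p.[t]} ->
  measurable_fun `[a, b] h /\
  (\int[leb]_(t in `[a, b]) (h t)%:E = (poly_int a b p)%:E)%E.
Proof.
move=> ab hp.
have mp (D : set R) : measurable_fun D (horner p) by exact: measurable_poly.
have mh : measurable_fun `]a, b[ h.
  by apply: eq_measurable_fun (mp _) => t; rewrite inE /= => /hp.
split; first exact: measurable_fun_itv_cc mh.
rewrite (@eq_integral_itv_bounded _ _ _ (horner p)) // -integral_poly // fineK //.
by apply: integrable_fin_num => //; exact: integrable_poly.
Qed.

Lemma integral_piecewise_poly (x : nat -> R) (P : nat -> {poly R}) (h : R -> R)
    (n N : nat) : (n <= N)%N ->
  (forall l, (n <= l < N)%N -> x l <= x l.+1) ->
  (forall l, (n <= l < N)%N -> {in `]x l, x l.+1[, forall t, h t = (P l).[t]}) ->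
  \int[leb]_(t in `[x n, x N]) h t = \sum_(n <= l < N) poly_int (x l) (x l.+1) (P l).
Proof.
move=> nN hx hP.
(* The induction also carries order and measurability, which splitting off the next piece of the
   integral requires. *)
suff [_ _ e] : [/\ x n <= x N, measurable_fun `[x n, x N] h &
    (\int[leb]_(t in `[x n, x N]) (h t)%:E =
     (\sum_(n <= l < N) poly_int (x l) (x l.+1) (P l))%:E)%E].
  by rewrite /Rintegral e.
elim: N nN hx hP => [|N IH].
  rewrite leqn0 => /eqP-> _ _; split=> //; rewrite set_itv1.
    exact: measurable_fun_set1.
  by rewrite big_geq // integral_set1.
rewrite leq_eqVlt => /predU1P[-> _ _|nN hx hP].
  split=> //; rewrite set_itv1; first exact: measurable_fun_set1.
  by rewrite big_geq // integral_set1.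
have [||x1 m1 e1] := IH nN.
- by move=> l /andP[l1 l2]; apply: hx; rewrite l1 ltnW.
- by move=> l /andP[l1 l2]; apply: hP; rewrite l1 ltnW.
have hN : (n <= N < N.+1)%N by rewrite ltnSn andbT.
have x2 := hx _ hN.
have [m2 e2] := integral_eq_poly_itvoo x2 (hP _ hN).
have m2' : measurable_fun `]x N, x N.+1] h.
  by apply: measurable_funS m2 => //; apply: subset_itvr; rewrite bnd_simp.
have U : `[x n, x N.+1]%classic = `[x n, x N] `|` `]x N, x N.+1].
  by rewrite -itv_bndbnd_setU // bnd_simp.
have mU : measurable_fun (`[x n, x N] `|` `]x N, x N.+1]) h.
  by apply/measurable_funU.
split; [exact: le_trans x2|by rewrite U|].
rewrite U integral_setU //=; last 2 first.
- exact/measurable_EFinP.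
- apply/disj_setPS => y [/=]; rewrite 2!in_itv/= => /andP[_ yx] /andP[].
  by rewrite ltNge yx.
rewrite e1 integral_itv_obnd_cbnd; last exact/measurable_EFinP.
by rewrite e2 -EFinD big_nat_recr.
Qed.

End PiecewiseIntegral.

(** * B-splines on a knot interval *)

Section BsplinePieces.
Variables (R : realType) (xi : nat -> R).

(* The polynomial with which the B-spline of degree q and index i coincides
   on [xi j, xi j.+1[. *)
Fixpoint bspline_poly (j q i : nat) : {poly R} :=
  match q with
  | 0%N => (i == j)%:R
  | q'.+1 =>
      (xi (i + q) - xi i)^-1 *: (('X - (xi i)%:P) * bspline_poly j q' i)
      + (xi (i + q + 1) - xi i.+1)^-1
        *: (((xi (i + q + 1))%:P - 'X) * bspline_poly j q' i.+1)
  end.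

Lemma bspline_polyS j q i : bspline_poly j q.+1 i =
  (xi (i + q.+1) - xi i)^-1 *: (('X - (xi i)%:P) * bspline_poly j q i)
  + (xi (i + q.+1 + 1) - xi i.+1)^-1
    *: (((xi (i + q.+1 + 1))%:P - 'X) * bspline_poly j q i.+1).
Proof. by []. Qed.

Lemma bspline_poly_supp j q i : (j < i)%N || (i + q < j)%N -> bspline_poly j q i = 0.
Proof.
elim: q i => [|q IH] i h.
  by rewrite /= (_ : (i == j) = false) //; apply/negbTE; lia.
by rewrite bspline_polyS !IH ?mulr0 ?scaler0 ?addr0 //; lia.
Qed.

Variable N : nat.
Hypothesis xi_mono : forall i j, (1 <= i)%N -> (i <= j <= N)%N -> xi i <= xi j.

Lemma bspline_polyE j q i eta : (1 <= j < N)%N -> (1 <= i)%N -> (i + q < N)%N ->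
  xi j <= eta < xi j.+1 -> bspline xi q i eta = (bspline_poly j q i).[eta].
Proof.
move=> hj i1 + /andP[eta1 eta2].
elim: q i i1 => [|q IH] i i1 iqN.
  rewrite /=; case: (ltngtP i j) => ij /=.
  - rewrite hornerC ifF //; apply/negbTE; rewrite negb_and -!leNgt -ltNge.
    by apply/orP; right; apply: le_trans eta1; apply: xi_mono; lia.
  - rewrite hornerC ifF //; apply/negbTE; rewrite negb_and -!leNgt -ltNge.
    by apply/orP; left; apply: lt_le_trans eta2 _; apply: xi_mono; lia.
  - by rewrite hornerC ij eta1 eta2.
rewrite bspline_polyS /=.
(* Off the support both sides are 0; on it the guard of the recursion holds and the two recursions
   agree term by term. *)
have [c|c] := boolP ((i <= j)%N && (j <= i + q.+1)%N); last first.
  rewrite !bspline_poly_supp ?mulr0 ?scaler0 ?addr0 ?horner0; [|lia..].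
  rewrite ifF //; apply/negbTE; rewrite negb_and -leNgt -ltNge; apply/orP.
  have [ji|ij] := ltnP j i; [left|right].
    by apply: lt_le_trans eta2 _; apply: xi_mono; lia.
  by apply: le_trans eta1; apply: xi_mono; lia.
rewrite ifT; last first.
  apply/andP; split; first by apply: le_trans eta1; apply: xi_mono; lia.
  by apply: lt_le_trans eta2 _; apply: xi_mono; lia.
rewrite !IH; [|lia..].
by rewrite hornerD !hornerZ !hornerM !hornerD !hornerN !hornerX !hornerC; ring.
Qed.

(* B-splines whose support starts at xi j vanish there to pairwise distinct
   orders, hence they are linearly independent on [xi j, xi j.+1[. *)
Lemma bspline_poly_order j q i : (j < N)%N -> (1 <= i <= j)%N -> (j <= i + q < N)%N ->
  xi i = xi j -> xi j < xi j.+1 ->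
  exists2 r, bspline_poly j q i = ('X - (xi j)%:P) ^+ (q - (j - i)) * r
           & 0 < r.[xi j].
Proof.
move=> jN + + + hj; elim: q i => [|q IH] i ij jiq e.
  exists 1; last by rewrite hornerC.
  have -> : i = j by lia.
  by rewrite /= eqxx subnn mul1r.
have pos n : (j < n <= N)%N -> 0 < xi n - xi j.
  by move=> n1; rewrite subr_gt0; apply: lt_le_trans hj _; apply: xi_mono; lia.
have eqj n : (i <= n <= j)%N -> xi n = xi j.
  move=> n1; apply/eqP; rewrite eq_le -{2}e; apply/andP; split; apply: xi_mono; lia.
(* Since [xi i = xi j], the factor ['X - xi i] raises the order of vanishing of the first term by
   one. *)
have [r1 E1 [p1 p1']] : exists2 r1,
    (xi (i + q.+1) - xi i)^-1 *: (('X - (xi i)%:P) * bspline_poly j q i) =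
    ('X - (xi j)%:P) ^+ (q.+1 - (j - i)) * r1
    & 0 <= r1.[xi j] /\ ((j <= i + q)%N -> 0 < r1.[xi j]).
  have [h|h] := leqP j (i + q); last first.
    exists 0; last by rewrite horner0; split=> //; lia.
    by rewrite bspline_poly_supp ?(mulr0, scaler0) //; lia.
  have [||r E rp] := IH i _ _ e; [lia|lia|].
  have rp' : 0 < ((xi (i + q.+1) - xi i)^-1 *: r).[xi j].
    by rewrite hornerZ mulr_gt0 // invr_gt0 e pos //; lia.
  exists ((xi (i + q.+1) - xi i)^-1 *: r); last by split=> //; exact: ltW.
  rewrite E e mulrA -exprS -scalerAr; congr (_ *: (_ ^+ _ * _)); lia.
(* For [i < j] the B-spline of index [i + 1] already has the right order, as
   [q - (j - (i + 1)) = q + 1 - (j - i)], and its factor is positive at [xi j]. *)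
have [r2 E2 [p2 p2']] : exists2 r2,
    (xi (i + q.+1 + 1) - xi i.+1)^-1
       *: (((xi (i + q.+1 + 1))%:P - 'X) * bspline_poly j q i.+1) =
    ('X - (xi j)%:P) ^+ (q.+1 - (j - i)) * r2
    & 0 <= r2.[xi j] /\ ((i < j)%N -> 0 < r2.[xi j]).
  have [h|h] := ltnP i j; last first.
    exists 0; last by rewrite horner0.
    by rewrite bspline_poly_supp ?(mulr0, scaler0) //; lia.
  have [|||r E rp] := IH i.+1; [lia|lia|by apply: eqj; lia|].
  set s := (xi (i + q.+1 + 1) - xi i.+1)^-1 *: (((xi (i + q.+1 + 1))%:P - 'X) * r).
  have sp : 0 < s.[xi j].
    rewrite /s hornerZ hornerM hornerD hornerN hornerC hornerX.
    by rewrite (eqj i.+1) ?mulr_gt0 ?invr_gt0 ?pos //; lia.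
  exists s; last by split=> //; exact: ltW.
  rewrite E /s -scalerAr mulrCA; congr (_ *: (_ ^+ _ * _)); lia.
(* Nonnegative cofactors cannot cancel, and one is positive: if [j > i + q], then
   [j = i + q + 1 > i]. *)
exists (r1 + r2); first by rewrite bspline_polyS E1 E2 mulrDr.
rewrite hornerD; have [h|h] := leqP j (i + q).
  by rewrite ltr_wpDr // p1'.
by rewrite ltr_wpDl // p2' //; lia.
Qed.

Lemma exists_last_eq_knot a b : (1 <= a)%N -> (a <= b <= N)%N -> xi a < xi b ->
  exists j, [/\ (a <= j < b)%N, xi j = xi a & xi j < xi j.+1].
Proof.
move=> a1; elim: b => [|b IH] h lt; first by lia.
have ab : (a <= b)%N.
  by rewrite leqNgt; apply/negP => ba; move: lt; rewrite (_ : b.+1 = a) ?ltxx //; lia.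
have [lt'|lt'|e] := ltgtP (xi a) (xi b).
- have [|j [j1 j2 j3]] := IH _ lt'; first by lia.
  by exists j; split => //; lia.
- by move: lt'; rewrite ltNge xi_mono //; lia.
- by exists b; split; [lia|rewrite e|rewrite -e].
Qed.

(** Strong induction on [i], on the nonempty piece [j] starting at the value [xi i]. There, smaller
    indices have zero coefficients, indices above [j] give zero, and those in between vanish at
    [xi j] to order higher than [p - (j - i)]. Comparing this order forces [c i = 0]. *)
Lemma bspline_poly_free p m (c : nat -> R) : (m + p < N)%N ->
  (forall i, (1 <= i <= m)%N -> xi i < xi (i + p + 1)) ->
  (forall l, (1 <= l <= m + p)%N -> xi l < xi l.+1 ->
     \sum_(1 <= i < m.+1) c i *: bspline_poly l p i = 0) ->
  forall i, (1 <= i <= m)%N -> c i = 0.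
Proof.
move=> mpN mult h i; elim/ltn_ind: i => i IH im.
have [||j [ij je jlt]] := @exists_last_eq_knot i (i + p + 1) _ _ (mult _ im); [lia|lia|].
have := h j; rewrite (bigD1_seq i) /= ?iota_uniq ?mem_index_iota; [|lia..].
have [|||||r -> rp] := @bspline_poly_order j p i; [lia|lia|lia|by []|by []|].
set X := 'X - _; move=> /(_ _ jlt) S.
have D : X ^+ (p - (j - i)) * X %| X ^+ (p - (j - i)) * (c i *: r).
  rewrite -scalerAr -(addrK (\sum_(1 <= i0 < m.+1 | i0 != i) c i0 *: bspline_poly j p i0) (c i *: _)).
  rewrite S ?sub0r; last by lia.
  rewrite dvdpNr big_seq_cond; apply: (big_ind (fun q => X ^+ (p - (j - i)) * X %| q)) => [||i']; first exact: dvdp0.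
    by move=> ? ?; exact: dvdp_add.
  rewrite mem_index_iota => /andP[i'm i'i].
  have [lti|gti] := ltnP i' i.
    by rewrite IH ?scale0r ?dvdp0 //; lia.
  have [i'j|ji'] := leqP i' j; last by rewrite bspline_poly_supp ?scaler0 ?dvdp0 ?ji'.
  have e' : xi i' = xi j.
    by apply/eqP; rewrite eq_le {2}je; apply/andP; split; apply: xi_mono; lia.
  have [|||||r' -> _] := @bspline_poly_order j p i'; [lia|lia|lia|by []|by []|].
  rewrite scalerAr -exprSr dvdp_mulr // dvdp_exp2l //; lia.
move: D; rewrite dvdp_mul2l ?expf_neq0 ?polyXsubC_eq0 // dvdp_XsubCl.
by rewrite rootE hornerZ mulf_eq0 (gt_eqF rp) orbF => /eqP.
Qed.
End BsplinePieces.

(** * Open knot vectors: end values, continuity and independence *)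

Section OpenKnots.
Variables (R : realType) (m p : nat) (xi : nat -> R).
Hypothesis hxi : open_knot_vector m p xi.

Local Notation bp := (bspline_poly xi).

Lemma knot_mono i j : (1 <= i)%N -> (i <= j <= m + p + 1)%N -> xi i <= xi j.
Proof.
have [h _ _] := hxi; move=> i1; elim: j => [|j IH] hj; first by lia.
have [ij|ij] := leqP i j; last by rewrite (_ : i = j.+1) //; lia.
by apply: le_trans (IH _) (h j _); lia.
Qed.

Lemma knot_eq0 i : (1 <= i <= p + 1)%N -> xi i = 0.
Proof. by have [_ h _] := hxi; move=> hi; apply/h; lia. Qed.

Lemma knot_eq1 i : (m + 1 <= i <= m + p + 1)%N -> xi i = 1.
Proof. by have [_ _ h] := hxi; move=> hi; apply/h; lia. Qed.

Lemma knot_degree_lt : (p < m)%N.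
Proof.
have [_ h0 h1] := hxi; rewrite ltnNge; apply/negP => mp.
have e0 : xi (p + 1)%N = 0 by apply: knot_eq0; lia.
have /eqP : xi (p + 1)%N = 1 by apply: knot_eq1; lia.
by rewrite e0 eq_sym oner_eq0.
Qed.

Lemma knot_gt0 i : (p + 1 < i <= m + p + 1)%N -> 0 < xi i.
Proof.
move=> hi; rewrite lt_neqAle -{2}(@knot_eq0 1) ?knot_mono ?andbT; [|lia..].
by have [_ h _] := hxi; apply/eqP => /esym /h; lia.
Qed.

Lemma knot_lt1 i : (1 <= i <= m)%N -> xi i < 1.
Proof.
move=> hi; rewrite lt_neqAle -{2}(@knot_eq1 (m + p + 1)) ?knot_mono ?andbT; [|lia..].
by have [_ _ h] := hxi; apply/eqP => /h; lia.
Qed.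

Lemma knot_piece_range l : (1 <= l <= m + p)%N -> xi l < xi l.+1 -> (p < l <= m)%N.
Proof.
move=> hl lt; rewrite ltnNge leqNgt; apply/andP.
split; apply/negP => h; move: lt.
  by rewrite !knot_eq0 ?ltxx //; lia.
by rewrite !knot_eq1 ?ltxx //; lia.
Qed.

Lemma knot_piece_sub l : (p < l <= m)%N -> {subset `]xi l, xi l.+1[ <= `]0, 1[}.
Proof.
move=> hl x; rewrite !in_itv /= => /andP[x1 x2]; apply/andP; split.
  by apply: le_lt_trans x1; rewrite -(@knot_eq0 1) ?knot_mono //; lia.
by apply: lt_le_trans x2 _; rewrite -(@knot_eq1 (m + p + 1)) ?knot_mono //; lia.
Qed.

Lemma bspline_knot_poly l i x : (p < l <= m)%N -> (1 <= i <= m)%N ->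
  xi l <= x < xi l.+1 -> bspline xi p i x = (bp l p i).[x].
Proof.
move=> hl hi hx; apply: (@bspline_polyE _ _ (m + p + 1)) => //; [|lia..].
exact: knot_mono.
Qed.

(** The recursion keeps [i + q] fixed in its second term, while the first carries the factor ['X],
    zero at 0. For [q = p] the condition reads [i > 1]: all B-splines but the dropped one. *)
Lemma bspline_poly_eq0_left l q i : (1 <= i)%N -> (l = p + 1)%N -> (q <= p)%N ->
  (p + 1 < i + q)%N -> (bp l q i).[0] = 0.
Proof.
move=> + ->; elim: q i => [|q IH] i i1 qp h.
  by rewrite bspline_poly_supp ?horner0 //; lia.
rewrite bspline_polyS hornerD !hornerZ !hornerM [X in _ + _ * (_ * X)]IH; [|lia..].
rewrite !mulr0 addr0; have [ip|ip] := leqP i (p + 1).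
  by rewrite (@knot_eq0 i) ?subr0 ?hornerX ?mul0r ?mulr0 //; lia.
by rewrite bspline_poly_supp ?ip // horner0 !mulr0.
Qed.

(** Mirror image on the last piece: when [i + 1 = m], the upper knot of the second term is 1 and its
    factor vanishes there. *)
Lemma bspline_poly_eq0_right q i : (1 <= i < m)%N -> (q <= p)%N -> (bp m q i).[1] = 0.
Proof.
elim: q i => [|q IH] i im qp.
  by rewrite bspline_poly_supp ?horner0 //; lia.
rewrite bspline_polyS hornerD !hornerZ !hornerM [X in _ * (_ * X) + _]IH; [|lia..].
rewrite !mulr0 add0r; have [ip|ip] := ltnP i.+1 m.
  by rewrite [(_ m q _).[_]]IH ?mulr0 //; lia.
by rewrite (@knot_eq1 (i + q.+1 + 1)) ?hornerD ?hornerN ?hornerX ?hornerC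
  ?subrr ?mul0r ?mulr0 //; lia.
Qed.

Hypothesis hC0 : spline_space_C0 m p xi.

Lemma bspline_continuous i : (1 <= i <= m)%N ->
  {in `]0, 1[, continuous (bspline xi p i : R -> R)}.
Proof.
move=> hi x hx; have := @hC0 (fun j => (j == i)%:R) x hx.
rewrite (_ : (fun _ => _) = bspline xi p i) //; apply/funext => y.
rewrite (bigD1_seq i) ?iota_uniq ?mem_index_iota //= eqxx mul1r big1 ?addr0 //.
by move=> j /negbTE ->; rewrite mul0r.
Qed.

(** The half-open recursion gives agreement only to the left of [xi l.+1]; continuity extends it to
    that knot, both values being the same left limit. *)
Lemma bspline_poly_knot l i : (p < l <= m)%N -> (1 <= i <= m)%N ->
  xi l < xi l.+1 < 1 -> (bp l p i).[xi l.+1] = bspline xi p i (xi l.+1).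
Proof.
move=> hl hi /andP[lt lt1].
have in01 : xi l.+1 \in `]0, 1[ by rewrite in_itv /= lt1 knot_gt0 //; lia.
have c1 := cvg_at_left_filter (bspline_continuous hi in01).
have c2 := cvg_at_left_filter (@continuous_horner _ (bp l p i) (xi l.+1)).
have c3 : bspline xi p i x @[x --> (xi l.+1)^'-] --> (bp l p i).[xi l.+1].
  apply: cvg_trans c2; apply: near_eq_cvg; near=> x; apply/esym.
  apply: bspline_knot_poly => //; apply/andP; split.
    by near: x; exact: nbhs_left_ge.
  by near: x; exact: nbhs_left_lt.
by rewrite -(cvg_lim _ c1) // -(cvg_lim _ c3).
Unshelve. all: by end_near. Qed.

(* At an interior knot of multiplicity above p the last B-spline ending there
   would jump from 1 to 0. *)
Lemma knot_multiplicity i : (1 <= i <= m)%N -> xi i < xi (i + p + 1)%N.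
Proof.
move=> hi; have pm := knot_degree_lt.
rewrite ltNge; apply/negP => le.
have i1 : (p + 1 < i)%N.
  rewrite ltnNge; apply/negP => ip; move: le.
  by rewrite (@knot_eq0 i) ?leNgt ?knot_gt0 //; lia.
have z01 : xi i < 1 by apply: knot_lt1.
have z0 : 0 < xi i by apply: knot_gt0; lia.
(* [a] indexes the nonempty piece that ends at the offending knot. *)
have [a [a1 a2 a3]] : exists a, [/\ (p < a < i)%N, xi a < xi a.+1 & xi a.+1 = xi i].
  clear le; elim: i i1 hi z01 z0 => [|i IH] i1 hi z01 z0; first by lia.
  have [lt|gt|e] := ltgtP (xi i) (xi i.+1).
  - by exists i; split => //; lia.
  - by move: gt; rewrite ltNge knot_mono //; lia.
  - have ip : (p + 1 < i)%N.
      rewrite ltnNge; apply/negP => ip; move: z0.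
      by rewrite -e (@knot_eq0 i) ?ltxx //; lia.
    have [|||a [a1 a2 a3]] := IH ip; [lia|by rewrite e|by rewrite e|].
    by exists a; split; [lia|by []|rewrite a3].
have eqz n : (a < n <= i + p + 1)%N -> xi n = xi i.
  move=> hn; apply/eqP; rewrite eq_le; apply/andP; split.
    by apply: le_trans le; apply: knot_mono; lia.
  by rewrite -a3; apply: knot_mono; lia.
(* The knots [xi (a + 1)], ..., [xi (a + q)] all coincide, so each first factor of the recursion
   equals 1 at the right end. *)
have v q : (q <= p)%N -> (bp a q a).[xi a.+1] = 1.
  elim: q => [|q IH] qp; first by rewrite /= eqxx hornerC.
  rewrite bspline_polyS [bspline_poly xi a q a.+1]bspline_poly_supp ?ltnSn //.
  rewrite mulr0 scaler0 addr0 hornerZ hornerM IH; last by lia.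
  rewrite mulr1 hornerD hornerN hornerX hornerC a3 (eqz (a + q.+1)%N); last by lia.
  by rewrite mulVf // subr_eq0 gt_eqF // -a3.
have := @bspline_poly_knot a a; rewrite v //.
(* The support is half-open and ends exactly at this knot. *)
have -> : bspline xi p a (xi a.+1) = 0.
  case: p (hi) (eqz) => [|q] hi' eqz' /=; first by rewrite ltxx andbF.
  by rewrite (eqz' (a + q.+1 + 1)%N) ?a3 ?ltxx ?andbF //; lia.
by move=> /(_ _ _ _)/eqP; rewrite oner_eq0 => H; apply/notF/H; rewrite ?a2 ?a3 //; lia.
Qed.

Lemma bspline_knot_free (c : nat -> R) :
  (forall l, (p < l <= m)%N -> xi l < xi l.+1 ->
     \sum_(1 <= i < m.+1) c i *: bp l p i = 0) ->
  forall i, (1 <= i <= m)%N -> c i = 0.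
Proof.
move=> h; apply: (@bspline_poly_free _ xi (m + p + 1) knot_mono p) => //; first by lia.
  exact: knot_multiplicity.
by move=> l hl lt; apply: h => //; exact: knot_piece_range.
Qed.

End OpenKnots.

(** * The time matrices: symmetry, integration by parts and definiteness *)

Section TimeMatrices.
Variables (R : realType) (T : R) (n p : nat) (xi : nat -> R).
Hypotheses (hT : 0 < T) (hxi : open_knot_vector n.+1 p xi)
  (hC0 : spline_space_C0 n.+1 p xi).

Local Notation tp l i := (bspline_poly xi l p i \Po (T^-1 *: 'X)).
Local Notation x l := (T * xi l).

Lemma time_basis_eq_poly l i t : (p < l <= n.+1)%N -> (i < n.+1)%N ->
  t \in `]x l, x l.+1[ -> time_basis T p xi i t = (tp l i.+1).[t].
Proof.
move=> hl hi ht.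
have tT : t / T \in `]xi l, xi l.+1[.
  by move: ht; rewrite !in_itv /= ltr_pdivlMr // ltr_pdivrMr // !(mulrC T).
have := knot_piece_sub hxi hl tT; rewrite in_itv /= => /andP[t0 t1].
rewrite /time_basis /bspline_ext (gt_eqF t0) (lt_eqF t1) (bspline_knot_poly hxi hl) //.
  by rewrite horner_comp hornerZ hornerX mulrC.
by move: tT; rewrite in_itv /= => /andP[/ltW -> ->].
Qed.

Lemma derive1_time_basis l i t : (p < l <= n.+1)%N -> (i < n.+1)%N ->
  t \in `]x l, x l.+1[ -> derive1 (time_basis T p xi i) t = ((tp l i.+1)^`()).[t].
Proof.
move=> hl hi ht; rewrite derivE !derive1E; apply: near_eq_derive.
near=> y; apply: (time_basis_eq_poly hl hi).
near: y; exact: near_in_itvoo.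
Unshelve. all: by end_near. Qed.

(** Since [xi p.+1 = 0] and [xi n.+2 = 1], the pieces from [p + 1] to [n + 1] already cover
    [[0, T]]. *)
Lemma time_integral (h : R -> R) (P : nat -> {poly R}) :
  (forall l, (p < l <= n.+1)%N -> {in `]x l, x l.+1[, forall t, h t = (P l).[t]}) ->
  \int[@lebesgue_measure R]_(t in `[0, T]) h t =
  \sum_(p.+1 <= l < n.+2) poly_int (x l) (x l.+1) (P l).
Proof.
move=> hP; have pn := knot_degree_lt hxi.
rewrite -(@integral_piecewise_poly _ (fun l => x l) P h p.+1 n.+2).
- rewrite (knot_eq0 hxi) ?(@knot_eq1 _ _ _ _ hxi n.+2) ?mulr0 ?mulr1 //; lia.
- by lia.
- by move=> l hl; rewrite ler_pM2l // (knot_mono hxi) //; lia.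
- by move=> l hl; apply: hP; lia.
Qed.

(** Matrix index [i] stands for basis function [i + 1], hence for B-spline [i + 2]. *)
Lemma time_ME i j : time_M T p xi n i j =
  \sum_(p.+1 <= l < n.+2) poly_int (x l) (x l.+1) (tp l i.+2 * tp l j.+2).
Proof.
rewrite mxE; apply: time_integral => l hl t ht.
by rewrite !(time_basis_eq_poly hl _ ht) ?hornerM //; rewrite ltnS.
Qed.

Lemma time_WE i j : time_W T p xi n i j =
  \sum_(p.+1 <= l < n.+2) poly_int (x l) (x l.+1) ((tp l j.+2)^`() * tp l i.+2).
Proof.
rewrite mxE; apply: time_integral => l hl t ht.
rewrite (time_basis_eq_poly hl _ ht) ?ltnS // (derive1_time_basis hl _ ht) ?ltnS //.
by rewrite hornerM.
Qed.

Lemma time_M_sym : (time_M T p xi n)^T = time_M T p xi n.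
Proof.
apply/matrixP => i j; rewrite mxE !time_ME.
by apply: eq_bigr => l _; rewrite [tp l j.+2 * _]mulrC.
Qed.

(* Integration by parts: only the last basis function is nonzero at T. *)
Lemma time_W_skew (i j : 'I_n) : (i.+1 < n)%N || (j.+1 < n)%N ->
  time_W T p xi n i j = - time_W T p xi n j i.
Proof.
move=> ij; apply/eqP; rewrite -addr_eq0 !time_WE -big_split /=.
have pn := knot_degree_lt hxi.
(* The common value at knot [l] of the two adjacent pieces. At the last knot the half-open B-spline
   is 0, so the polynomial of the last piece is evaluated instead. *)
pose V (a l : nat) := if (l <= n.+1)%N then bspline xi p a (xi l)
  else (bspline_poly xi n.+1 p a).[1].
have tpE l a s : (tp l a).[T * s] = (bspline_poly xi l p a).[s].
  by rewrite horner_comp hornerZ hornerX mulKf // gt_eqF.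
have VL a l : (1 <= a <= n.+1)%N -> (p < l <= n.+1)%N -> xi l < xi l.+1 ->
    (tp l a).[x l] = V a l.
  move=> ha hl lt; rewrite tpE /V; case/andP: (hl) => _ ->.
  by rewrite (bspline_knot_poly hxi hl) // lexx.
have VR a l : (1 <= a <= n.+1)%N -> (p < l <= n.+1)%N -> xi l < xi l.+1 ->
    (tp l a).[x l.+1] = V a l.+1.
  move=> ha hl lt; rewrite tpE /V; case: ifPn => h.
    by apply: (bspline_poly_knot hxi hC0) => //; rewrite lt (knot_lt1 hxi) //; lia.
  have -> : l = n.+1 by lia.
  by rewrite (knot_eq1 hxi) //; lia.
rewrite (eq_big_nat _ _ (F2 := fun l => V i.+2 l.+1 * V j.+2 l.+1 - V i.+2 l * V j.+2 l)).
  rewrite telescope_sumr; last by lia.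
  (* After telescoping only the boundary terms remain; the one at 0 vanishes because the first
     B-spline is dropped. *)
  have V0 (a : 'I_n) : V a.+2 p.+1 = 0.
    have an := ltn_ord a.
    have lt : xi p.+1 < xi p.+2.
      by rewrite (@knot_eq0 _ _ _ _ hxi p.+1) ?(knot_gt0 hxi) //; lia.
    rewrite -VL //; [|lia..].
    rewrite tpE (knot_eq0 hxi); last by lia.
    by apply: (bspline_poly_eq0_left hxi); lia.
  rewrite !V0 mulr0 subr0 /V ltnn.
  have V1 (a : 'I_n) : (a.+1 < n)%N -> (bspline_poly xi n.+1 p a.+2).[1] = 0.
    by move=> h; apply: (bspline_poly_eq0_right hxi); lia.
  by case/orP: ij => /V1 ->; rewrite ?mul0r ?mulr0.
move=> l hl; have hl' : (p < l <= n.+1)%N by lia.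
(* A repeated knot contributes nothing on either side; such a piece is never the last one, as
   [xi n.+1 < 1]. *)
have [lt|] := ltP (xi l) (xi l.+1); last first.
  move=> ge; have e : xi l = xi l.+1.
    by apply/eqP; rewrite eq_le ge (knot_mono hxi) //; lia.
  have en a : V a l.+1 = V a l.
    rewrite /V -e; case/andP: hl' => _ ->; case: ifPn => // h.
    have := @knot_lt1 _ _ _ _ hxi l; rewrite e (knot_eq1 hxi) ?ltxx; [|lia..].
    by move=> H; have : false by apply: H; lia.
  by rewrite e /poly_int !subrr addr0 !en subrr.
rewrite -linearD /= [X in poly_int _ _ X](_ : _ = (tp l i.+2 * tp l j.+2)^`()).
  by rewrite poly_int_deriv !hornerM !VL ?VR //; have := ltn_ord i; have := ltn_ord j; lia.
by rewrite derivM; ring.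
Qed.

Lemma time_M_quad (u : 'cV[R]_n) : (u^T *m time_M T p xi n *m u) 0 0 =
  \sum_(p.+1 <= l < n.+2) poly_int (x l) (x l.+1)
     ((\sum_i u i 0 *: tp l i.+2) * (\sum_i u i 0 *: tp l i.+2)).
Proof.
rewrite mxE; under eq_bigr => j _ do rewrite mxE mulr_suml.
under [RHS]eq_bigr => l _.
  rewrite mulr_sumr linear_sum /=.
  under eq_bigr => j _.
    rewrite mulr_suml linear_sum /=.
    under eq_bigr => i _ do rewrite -scalerAl -scalerAr !linearZ /=.
    over.
  over.
rewrite [RHS]exchange_big /=; apply: eq_bigr => j _.
rewrite [RHS]exchange_big /=; apply: eq_bigr => i _.
rewrite mxE time_ME mulr_sumr mulr_suml; apply: eq_bigr => l _.
by rewrite /GRing.scale /=; ring.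
Qed.

(** The quadratic form is a sum of integrals of squares; if it is 0, the combination vanishes on
    every nonempty piece, and independence of the B-splines gives [u = 0]. *)
Lemma time_M_posdef (u : 'cV[R]_n) : u != 0 -> 0 < (u^T *m time_M T p xi n *m u) 0 0.
Proof.
move=> u0; rewrite time_M_quad.
set s := fun l => \sum_i u i 0 *: tp l i.+2.
have xle l : (p.+1 <= l < n.+2)%N -> x l <= x l.+1.
  by move=> hl; rewrite ler_pM2l // (knot_mono hxi) //; lia.
have ge0 l : (p.+1 <= l < n.+2)%N -> 0 <= poly_int (x l) (x l.+1) (s l * s l).
  by move=> hl; apply/poly_int_sqr_ge0/xle.
rewrite lt_neqAle; apply/andP; split; last first.
  by rewrite big_seq; apply: sumr_ge0 => l; rewrite mem_index_iota => /ge0.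
apply: contra u0 => /eqP/esym e.
(* Coefficients over all B-splines: 0 for the dropped first one, entry [a - 2] of [u] for the
   B-spline of index [a]. *)
pose c a := if a is a'.+2 then if insub a' is Some o then u o 0 else 0 else 0 : R.
have cE (o : 'I_n) : c o.+2 = u o 0 by rewrite /c valK.
suff H : forall a, (1 <= a <= n.+1)%N -> c a = 0.
  by apply/eqP/colP => o; rewrite mxE -cE H //= ltnS.
apply: (bspline_knot_free hxi hC0) => l hl lt.
have sl : s l = 0.
  apply: (@poly_int_sqr_eq0 _ (x l) (x l.+1)); first by rewrite ltr_pM2l.
  move: e; rewrite big_seq => /eqP; rewrite psumr_eq0; last first.
    by move=> l'; rewrite mem_index_iota => /ge0.
  move=> /allP /(_ l); rewrite mem_index_iota => /(_ hl) /implyP.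
  by move=> /(_ hl) /eqP.
rewrite big_nat_recl // scale0r add0r big_add1 /= big_mkord.
(* Composing with [T *: 'X] undoes the rescaling of time. *)
have := congr1 (fun q => q \Po (T *: 'X)) sl.
rewrite /s comp_poly0 linear_sum /= => E; rewrite -[RHS]E; apply: eq_bigr => o _.
rewrite valK comp_polyZ -comp_polyA comp_polyZ comp_polyX scalerA mulVf ?gt_eqF //.
by rewrite scale1r comp_polyXr.
Qed.

End TimeMatrices.

(** * Hermitian pairs *)

Section HermitianPairs.
Variable C : numClosedFieldType.

Lemma trmxC_mul a b c (A : 'M[C]_(a, b)) (B : 'M[C]_(b, c)) :
  (A *m B)^t* = B^t* *m A^t*.
Proof. by rewrite trmx_mul map_mxM. Qed.

(** A one-sided inverse is two-sided: [M *m U *m U^t* = 1], which cancels in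
    [M *m U *m (U^t* *m W *m U)]. *)
Lemma congruence_eigen n (M W U L : 'M[C]_n) : U^t* *m M *m U = 1%:M ->
  U^t* *m W *m U = L -> W *m U = M *m U *m L.
Proof.
move=> h <-; have e : M *m U *m U^t* = 1%:M by apply: mulmx1C; rewrite mulmxA.
by rewrite !mulmxA e mul1mx.
Qed.

Lemma hermitian_pair_eigendecomposition n (M W : 'M[C]_n) : M^t* = M ->
  (forall z : 'cV[C]_n, z != 0 -> 0 < (z^t* *m M *m z) 0 0) -> W^t* = - W ->
  exists U L : 'M[C]_n, [/\ is_diag_mx L, L^t* = - L, W *m U = M *m U *m L
    & U^t* *m M *m U = 1%:M].
Proof.
move=> hM pM hW.
have /orthomx_spectralP : M \is normalmx by apply/normalmxP; rewrite hM.
have uP := spectral_unitarymx M.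
rewrite invmx_unitary //; set P := spectralmx M in uP *; set d := spectral_diag M => eM.
have PP : P *m P^t* = 1%:M by apply/unitarymxP.
have dE : P *m M *m P^t* = diag_mx d.
  by rewrite eM !mulmxA PP mul1mx -mulmxA PP mulmx1.
(* The eigenvalue is the value of the form at the corresponding eigenvector. *)
have d0 i : 0 < d 0 i.
  pose z : 'cV[C]_n := P^t* *m delta_mx i 0.
  have := pM z.
  have -> : (z^t* *m M *m z) 0 0 = d 0 i.
    rewrite /z trmxC_mul trmxCK -!mulmxA (mulmxA M) (mulmxA P) (mulmxA P) dE.
    rewrite trmx_delta map_delta_mx mulmxA -rowE -colE !mxE eqxx mulr1n.
    by [].
  apply; apply/negP => /eqP /(congr1 (mulmx P)); rewrite /z mulmxA PP mul1mx mulmx0.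
  by move=> /matrixP /(_ i 0); rewrite !mxE !eqxx => /eqP; rewrite oner_eq0.
pose e : 'rV[C]_n := \row_i (sqrtC (d 0 i))^-1.
have eC : (diag_mx e)^t* = diag_mx e.
  apply/matrixP => i j; rewrite !mxE; case: (eqVneq j i) => [->|_].
    rewrite !mulr1n; apply: geC0_conj.
    by rewrite invr_ge0 sqrtC_ge0 ltW.
  by rewrite !mulr0n rmorph0.
(* [S] is the unitary eigenbasis of [M] with columns rescaled by the inverse square roots of the
   eigenvalues. *)
have [S SMS] : exists S : 'M[C]_n, S^t* *m M *m S = 1%:M.
  exists (P^t* *m diag_mx e).
  rewrite trmxC_mul trmxCK eC -!mulmxA (mulmxA M) (mulmxA P) (mulmxA P) dE.
  rewrite !mulmx_diag; apply/matrixP => i j; rewrite !mxE; congr (_ *+ _).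
  have s0 : sqrtC (d 0 i) != 0 by rewrite sqrtC_eq0 gt_eqF.
  by rewrite -[X in _ * (X * _)]sqrtCK expr2 mulfK // mulVf.
(* Congruence keeps [K] skew-Hermitian, hence normal, so a unitary diagonalization exists and
   preserves the normalization by [M]. *)
set K := S^t* *m W *m S.
have hK : K^t* = - K.
  by rewrite /K !trmxC_mul trmxCK hW mulNmx mulmxN mulmxA.
have /orthomx_spectralP : K \is normalmx.
  by apply/normalmxP; rewrite hK mulmxN mulNmx.
have uQ := spectral_unitarymx K.
rewrite invmx_unitary //; set Q := spectralmx K in uQ *; set l := spectral_diag K => eK.
have QQ : Q *m Q^t* = 1%:M by apply/unitarymxP.
have lE : Q *m K *m Q^t* = diag_mx l.
  by rewrite eK !mulmxA QQ mul1mx -mulmxA QQ mulmx1.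
have UMU : (S *m Q^t*)^t* *m M *m (S *m Q^t*) = 1%:M.
  rewrite trmxC_mul trmxCK -!mulmxA (mulmxA M) (mulmxA (S^t*)) (mulmxA (S^t*)) SMS.
  by rewrite mul1mx QQ.
exists (S *m Q^t*), (diag_mx l); split=> //.
- by rewrite -lE trmxC_mul trmxC_mul trmxCK hK mulNmx mulmxN mulmxA.
- apply: congruence_eigen => //.
  rewrite trmxC_mul trmxCK -!mulmxA (mulmxA W) (mulmxA (S^t*)) (mulmxA (S^t*)).
  by rewrite -/K mulmxA lE.
Qed.

(** A nonzero kernel vector would give the form the value 0. The transpose appears because [kermx]
    is the left kernel. *)
Lemma posdef_unitmx n (M : 'M[C]_n) :
  (forall z : 'cV[C]_n, z != 0 -> 0 < (z^t* *m M *m z) 0 0) -> M \in unitmx.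
Proof.
move=> pM; rewrite -unitmx_tr -row_free_unit -kermx_eq0; apply/eqP/row_matrixP => i.
rewrite row0; apply/eqP/negPn/negP => ne.
have := pM (row i (kermx M^T))^T; rewrite trmx_eq0 => /(_ ne).
rewrite -mulmxA (_ : M *m _ = 0) ?mulmx0 ?mxE ?ltxx //.
by apply: trmx_inj; rewrite trmx_mul trmxK trmx0 -row_mul mulmx_ker row0.
Qed.

(** The equation for [v] says that [row_mx M0 m *m z = 0]: the new column [z] is [M]-orthogonal to
    the columns of [U0] padded by 0. The factor [(sqrtC q)^-1] then normalizes it. *)
Lemma bordered_congruence k (M W : 'M[C]_(k + 1)) (M0 W0 U0 L0 : 'M[C]_k)
    (m w v : 'cV[C]_k) (mu omega : 'M[C]_1) :
  M = block_mx M0 m (m^t*) mu -> W = block_mx W0 w (- w^t*) omega ->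
  M^t* = M -> W0^t* = - W0 -> W0 *m U0 = M0 *m U0 *m L0 ->
  U0^t* *m M0 *m U0 = 1%:M -> M0 *m v = - m ->
  let v1 := col_mx v 1%:M in
  let q := (v1^t* *m M *m v1) 0 0 in
  0 < q ->
  let z := (sqrtC q)^-1 *: v1 in
  let r := usubmx z in
  let rho := dsubmx z in
  let U := block_mx U0 r 0 rho in
  let g := U0^t* *m row_mx W0 w *m col_mx r rho in
  let sigma := row_mx (r^t*) (rho^t*) *m W *m col_mx r rho in
  U^t* *m M *m U = 1%:M /\ U^t* *m W *m U = block_mx L0 g (- g^t*) sigma.
Proof.
move=> ME WE hM hW0 eW U0M e v1 q q0 z r rho U.
have zE : col_mx r rho = z by rewrite vsubmxK.
have zCE : row_mx (r^t*) (rho^t*) = z^t* by rewrite -zE tr_col_mx map_row_mx.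
rewrite zE zCE => g sigma.
have UE : U = row_mx (col_mx U0 0) z by rewrite /U block_mxEh zE.
have UCE : U^t* = col_mx (row_mx (U0^t*) 0) (z^t*).
  by rewrite UE tr_row_mx map_col_mx tr_col_mx map_row_mx trmx0 map_mx0.
have AM (N : 'M[C]_(k + 1)) N0 n1 n2 n3 : N = block_mx N0 n1 n2 n3 ->
    row_mx (U0^t*) 0 *m N = U0^t* *m row_mx N0 n1.
  by move=> ->; rewrite mul_row_block !mul0mx !addr0 mul_mx_row.
have MA (N : 'M[C]_(k + 1)) N0 n1 n2 n3 : N = block_mx N0 n1 n2 n3 ->
    N *m col_mx U0 0 = col_mx N0 n2 *m U0.
  by move=> ->; rewrite mul_block_col !mulmx0 !addr0 mul_col_mx.
have zM : row_mx M0 m *m z = 0.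
  by rewrite /z -scalemxAr mul_row_col mulmx1 e addNr scaler0.
have blk (N : 'M[C]_(k + 1)) : U^t* *m N *m U =
    block_mx (row_mx (U0^t*) 0 *m N *m col_mx U0 0) (row_mx (U0^t*) 0 *m N *m z)
             (z^t* *m (N *m col_mx U0 0)) (z^t* *m N *m z).
  by rewrite UCE UE mul_col_mx mul_col_row (mulmxA (z^t*)).
rewrite !blk (AM _ _ _ _ _ ME) (AM _ _ _ _ _ WE) (MA _ _ _ _ _ ME) (MA _ _ _ _ _ WE).
rewrite -!(mulmxA (U0^t*)) !mul_row_col !mulmx0 !addr0 zM mulmx0 eW !mulmxA U0M mul1mx.
have zMC : z^t* *m col_mx M0 (m^t*) = 0.
  have : (row_mx M0 m *m z)^t* = 0 by rewrite zM trmx0 map_mx0.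
  rewrite trmxC_mul tr_row_mx map_col_mx.
  by move: hM; rewrite ME tr_block_mx map_block_mx => /eq_block_mx[-> _ _ _].
rewrite zMC mul0mx; split.
  have zMz : z^t* *m M *m z = 1%:M.
    have s0 : 0 < sqrtC q by rewrite sqrtC_gt0.
    have zC : z^t* = (sqrtC q)^-1 *: v1^t*.
      have c0 : ((sqrtC q)^-1)^* = (sqrtC q)^-1 by rewrite geC0_conj // invr_ge0 ltW.
      by rewrite /z linearZ /= map_mxZ /= c0.
    rewrite zC -!scalemxAl -scalemxAr scalerA [_ *m v1]mx11_scalar -/q.
    by rewrite scale_scalar_mx -[X in _ * X]sqrtCK expr2 mulrA mulfVK ?mulVf ?gt_eqF.
  by rewrite zMz -scalar_mx_block.
(* Only the lower left block is left; it is [- g^t*] because [W0] is skew-Hermitian. *)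
congr block_mx.
rewrite /g -mulmxA trmxC_mul trmxC_mul trmxCK tr_row_mx map_col_mx hW0.
by rewrite -[RHS]mulmxN -[in RHS]mulNmx opp_col_mx opprK.
Qed.
End HermitianPairs.

(** * The spectral norm *)

Section SpectralNorm.
Variable R : realType.
Local Notation C := R[i].

Lemma euclid_norm_ge0 n (x : 'cV[C]_n) : 0 <= euclid_norm x.
Proof. exact: sqrtr_ge0. Qed.

Lemma euclid_norm_sqr n (x : 'cV[C]_n) :
  (x^t* *m x) 0 0 = real_complex R (euclid_norm x ^+ 2).
Proof.
rewrite /euclid_norm sqr_sqrtr; last by apply: sumr_ge0 => i _; rewrite sqr_ge0.
rewrite rmorph_sum mxE; apply: eq_bigr => i _.
by rewrite rmorphXn !mxE mulrC -normCK.
Qed.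

Lemma euclid_norm_eq0 n (x : 'cV[C]_n) : euclid_norm x = 0 -> x = 0.
Proof.
move=> /eqP; rewrite sqrtr_eq0 => h; apply/colP => i; rewrite mxE.
have := h; rewrite le_eqVlt ltNge sumr_ge0 => [|j _]; last by rewrite sqr_ge0.
rewrite orbF psumr_eq0 => [|j _]; last by rewrite sqr_ge0.
move=> /allP /(_ i (mem_index_enum i)); rewrite /= sqrf_eq0 => /eqP.
exact: Normc.eq0_normc.
Qed.

Lemma euclid_normZ n a (x : 'cV[C]_n) : 0 <= a ->
  euclid_norm (real_complex R a *: x) = a * euclid_norm x.
Proof.
move=> a0; have h : euclid_norm (real_complex R a *: x) ^+ 2 = (a * euclid_norm x) ^+ 2.
  have aC : (real_complex R a *: x)^t* = real_complex R a *: x^t*.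
    apply/matrixP => i j; rewrite !mxE rmorphM; congr (_ * _); exact: conjc_real.
  apply: (@complexI R); rewrite -euclid_norm_sqr aC -scalemxAl -scalemxAr.
  by rewrite scalerA mxE euclid_norm_sqr exprMn [RHS]rmorphM [in RHS]rmorphXn /= expr2.
by move/eqP: h; rewrite eqrXn2 ?mulr_ge0 ?euclid_norm_ge0 // => /eqP.
Qed.

Lemma euclid_CauchySchwarz n (x y : 'cV[C]_n) :
  Normc.normc ((x^t* *m y) 0 0) <= euclid_norm x * euclid_norm y.
Proof.
rewrite -(@ler_pXn2r _ 2) ?nnegrE ?mulr_ge0 ?euclid_norm_ge0 //; last first.
  by rewrite -lecR; exact: (normr_ge0 ((x^t* *m y) 0 0)).
have h : `|dotmx (x^t*) (y^t*)| ^+ 2 <= dotmx (x^t*) (x^t*) * dotmx (y^t*) (y^t*).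
  exact: (CauchySchwarz (@dotmx _ n) (x^t*) (y^t*)).1.
move: h; rewrite !dotmxE !trmxCK !euclid_norm_sqr => h.
by rewrite -lecR exprMn [X in _ <= X]rmorphM rmorphXn.
Qed.

(** The left side is the inner product of [x] with [X^t* *m X *m x], to which Cauchy-Schwarz
    applies. *)
Lemma euclid_norm_mulmx_sqr_le m n (X : 'M[C]_(m, n)) (x : 'cV[C]_n) :
  euclid_norm (X *m x) ^+ 2 <= euclid_norm x * euclid_norm (X^t* *m (X *m x)).
Proof.
apply: le_trans (euclid_CauchySchwarz _ _); rewrite -lecR -euclid_norm_sqr.
rewrite trmxC_mul -mulmxA; set z := (_ *m _) 0 0.
have : z = `|z|; last by move=> {1}->; exact: lexx.
rewrite ger0_norm // /z mulmxA -trmxC_mul euclid_norm_sqr lecR.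
by rewrite sqr_ge0.
Qed.

(** Cauchy-Schwarz on each row yields the Frobenius norm as a bound; the set in [norm2] is thus
    bounded and its [sup] is a true supremum. *)
Lemma euclid_norm_mulmx_bounded n (X : 'M[C]_n) :
  exists B, forall x, euclid_norm (X *m x) <= B * euclid_norm x.
Proof.
pose r i := euclid_norm ((row i X)^t*).
exists (Num.sqrt (\sum_i r i ^+ 2)) => x.
have r0 : 0 <= \sum_i r i ^+ 2 by apply: sumr_ge0 => i _; rewrite sqr_ge0.
rewrite -(@ler_pXn2r _ 2) ?nnegrE ?mulr_ge0 ?euclid_norm_ge0 ?sqrtr_ge0 //.
rewrite exprMn [X in _ <= X * _]sqr_sqrtr // [X in X <= _]sqr_sqrtr; last first.
  by apply: sumr_ge0 => i _; rewrite sqr_ge0.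
rewrite mulr_suml ler_sum // => i _; rewrite -exprMn.
have nx : 0 <= Normc.normc ((X *m x) i 0).
  by rewrite -lecR; exact: (normr_ge0 ((X *m x) i 0)).
rewrite ler_pXn2r ?nnegrE ?mulr_ge0 ?euclid_norm_ge0 //.
have -> : (X *m x) i 0 = ((row i X)^t*^t* *m x) 0 0 by rewrite trmxCK -row_mul [RHS]mxE.
exact: euclid_CauchySchwarz.
Qed.

Lemma norm2_ub n (X : 'M[C]_n) x : euclid_norm (X *m x) <= norm2 X * euclid_norm x.
Proof.
have [e|ne] := eqVneq (euclid_norm x) 0.
  rewrite e mulr0 (euclid_norm_eq0 e) mulmx0 -(euclid_norm_eq0 e).
  by rewrite e.
have x0 : 0 < euclid_norm x by rewrite lt_neqAle eq_sym ne euclid_norm_ge0.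
set a := (euclid_norm x)^-1; have a0 : 0 <= a by rewrite invr_ge0 ltW.
rewrite -ler_pdivrMr // mulrC -euclid_normZ // scalemxAr.
have [B hB] := euclid_norm_mulmx_bounded X.
apply: ub_le_sup.
  by exists B => _ /= [y y1 <-]; rewrite -[B]mulr1 -y1; exact: hB.
by exists (real_complex R a *: x) => //=; rewrite euclid_normZ // mulVf.
Qed.

Lemma euclid_unit_exists n : (0 < n)%N -> exists x : 'cV[C]_n, euclid_norm x = 1.
Proof.
move=> n0; exists (delta_mx (Ordinal n0) 0); rewrite /euclid_norm.
rewrite (bigD1 (Ordinal n0)) //= big1 => [|i /negbTE ne]; last first.
  by rewrite mxE ne andFb mulr0n [Normc.normc _](Normc.normc0 R) expr0n.
by rewrite mxE !eqxx mulr1n [Normc.normc _](Normc.normc1 R) expr1n addr0 sqrtr1.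
Qed.

Lemma norm2_le n (X : 'M[C]_n) b : (0 < n)%N ->
  (forall x, euclid_norm (X *m x) <= b * euclid_norm x) -> norm2 X <= b.
Proof.
move=> n0 h; have [x x1] := euclid_unit_exists n0.
apply: sup_le_ub; first by exists (euclid_norm (X *m x)), x.
by move=> _ /= [y y1 <-]; rewrite -[b]mulr1 -y1; exact: h.
Qed.

Lemma norm2_ge0 n (X : 'M[C]_n) : (0 < n)%N -> 0 <= norm2 X.
Proof.
move=> n0; have [x x1] := euclid_unit_exists n0.
by apply: le_trans (euclid_norm_ge0 (X *m x)) _; rewrite -[norm2 X]mulr1 -x1 norm2_ub.
Qed.

Lemma norm2M n (X Y : 'M[C]_n) : (0 < n)%N -> norm2 (X *m Y) <= norm2 X * norm2 Y.
Proof.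
move=> n0; apply: norm2_le => // x; rewrite -mulmxA -mulrA.
apply: le_trans (norm2_ub _ _) _.
by rewrite ler_wpM2l ?norm2_ge0 ?norm2_ub.
Qed.

Lemma norm2_sqr_le n (X : 'M[C]_n) : (0 < n)%N -> norm2 X ^+ 2 <= norm2 (X^t* *m X).
Proof.
move=> n0; have g0 := norm2_ge0 (X^t* *m X) n0.
rewrite -[leRHS]sqr_sqrtr // ler_pXn2r ?nnegrE ?norm2_ge0 ?sqrtr_ge0 //.
apply: norm2_le => // x.
rewrite -(@ler_pXn2r _ 2) ?nnegrE ?mulr_ge0 ?euclid_norm_ge0 ?sqrtr_ge0 //.
apply: le_trans (euclid_norm_mulmx_sqr_le _ _) _.
rewrite exprMn sqr_sqrtr // expr2 mulrCA ler_wpM2l ?euclid_norm_ge0 //.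
by rewrite mulmxA norm2_ub.
Qed.

(** [|Y|^2 <= |Y^* Y| <= |Y^*| |Y|]; cancelling [|Y|] gives one inequality, and [Y = X^*] the
    other. *)
Lemma norm2_trmxC n (X : 'M[C]_n) : (0 < n)%N -> norm2 (X^t*) = norm2 X.
Proof.
move=> n0; suff h (Y : 'M[C]_n) : norm2 Y <= norm2 (Y^t*).
  have h1 := h X; have h2 := h (X^t*); rewrite trmxCK in h2.
  by apply/le_anti/andP; split; [exact: h2|exact: h1].
have [e|ne] := eqVneq (norm2 Y) 0; first by rewrite e norm2_ge0.
have y0 : 0 < norm2 Y by rewrite lt_neqAle eq_sym ne norm2_ge0.
have := le_trans (norm2_sqr_le Y n0) (norm2M (Y^t*) Y n0).
by rewrite expr2 (ler_pM2r y0).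
Qed.

Lemma norm2_gram n (X : 'M[C]_n) : (0 < n)%N -> norm2 (X^t* *m X) = norm2 X ^+ 2.
Proof.
move=> n0; apply/eqP; rewrite eq_le norm2_sqr_le // andbT.
by rewrite expr2 -[X in X * _]norm2_trmxC // norm2M.
Qed.

Lemma kappa2_congruence n (M U : 'M[C]_n) : (0 < n)%N -> U^t* *m M *m U = 1%:M ->
  kappa2 U = Num.sqrt (kappa2 M).
Proof.
move=> n0 e.
have eU : (U^t* *m M) *m U = 1%:M by [].
have [_ uU] := mulmx1_unit eU.
have [uC uMU] := mulmx1_unit (etrans (mulmxA _ _ _) e).
have MU : M *m U *m U^t* = 1%:M by apply: mulmx1C; rewrite mulmxA.
have uM : M \in unitmx by have := MU; rewrite -mulmxA => /mulmx1_unit[].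
(* Both [M] and its inverse become Gram matrices, of [invmx U] and of [U^t*], so their norms are
   squares. *)
have iM : invmx M = (U^t*)^t* *m U^t*.
  by rewrite trmxCK -[LHS]mulmx1 -MU -!mulmxA mulKmx.
have ME : M = (invmx U)^t* *m invmx U.
  have iC : (invmx U)^t* = M *m U.
    rewrite -[LHS]mul1mx -MU -(mulmxA (M *m U)) -trmxC_mul mulVmx //.
    by rewrite trmx1 map_mx1 mulmx1.
  by rewrite iC mulmxK.
have P : 0 <= norm2 (invmx U) * norm2 U by apply: mulr_ge0; apply: norm2_ge0.
rewrite /kappa2 iM norm2_gram // norm2_trmxC // ME norm2_gram // -exprMn.
rewrite sqrtr_sqr (ger0_norm P); exact: mulrC.
Qed.

End SpectralNorm.

(** * From real to complex matrices *)

Section Complexification.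
Variable R : realType.

Lemma cplx_mx_trC m n (A : 'M[R]_(m, n)) : (cplx_mx A)^t* = cplx_mx A^T.
Proof. by apply/matrixP => i j; rewrite !mxE; exact: conjc_real. Qed.

(** For [z = a + i b] the cross terms cancel by symmetry of [M], leaving the sum of the real forms
    at [a] and [b], one of which is nonzero. *)
Lemma cplx_posdef n (M : 'M[R]_n) : M^T = M ->
  (forall u : 'cV[R]_n, u != 0 -> 0 < (u^T *m M *m u) 0 0) ->
  forall z : 'cV[R[i]]_n, z != 0 -> 0 < (z^t* *m cplx_mx M *m z) 0 0.
Proof.
move=> hM pM z z0; pose a := map_mx (@complex.Re R) z; pose b := map_mx (@complex.Im R) z.
have zE : z = cplx_mx a + 'i%C *: cplx_mx b.
  by apply/matrixP => i j; rewrite !mxE [LHS]complexE.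
have zC : z^t* = cplx_mx a^T - 'i%C *: cplx_mx b^T.
  rewrite zE linearD map_mxD /= cplx_mx_trC; congr (_ + _).
  apply/matrixP => i j; rewrite !mxE rmorphM -mulNr; congr (_ * _).
    by apply/eqP; rewrite eq_complex /= oppr0 !eqxx.
  exact: conjc_real.
have ab : b^T *m M *m a = a^T *m M *m b.
  have -> : b^T *m M *m a = (a^T *m M *m b)^T by rewrite !trmx_mul trmxK hM mulmxA.
  by apply/matrixP => i j; rewrite !ord1 mxE.
have -> : (z^t* *m cplx_mx M *m z) 0 0 =
    real_complex R ((a^T *m M *m a) 0 0 + (b^T *m M *m b) 0 0).
  rewrite zC zE !mulmxDr !mulmxBl -!scalemxAl -!scalemxAr -!map_mxM.
  rewrite scalerA -expr2 sqr_i scaleN1r opprK ab.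
  rewrite addrA subrK -map_mxD [LHS]mxE; congr (real_complex R _).
  by rewrite [LHS]mxE.
have pM' (u : 'cV[R]_n) : 0 <= (u^T *m M *m u) 0 0.
  have [->|u0] := eqVneq u 0; first by rewrite mulmx0 mxE.
  exact: ltW (pM u u0).
rewrite ltcR; have [a0|a0] := eqVneq a 0.
  apply: ltr_wpDl => //; apply: (pM b); apply: contra z0 => /eqP b0.
  by rewrite zE a0 b0 /cplx_mx !map_mx0 scaler0 addr0.
apply: ltr_wpDr => //; exact: (pM a a0).
Qed.

Lemma Re_eq0_conj (x : R[i]) : x^* = - x -> complex.Re x = 0.
Proof. by case: x => a b /eqP; rewrite eq_complex /= => /andP[/eqP h _]; lra. Qed.

End Complexification.

(* n_t = k + 1, i.e. m_t = k + 2 *)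
Theorem mainTheorem2 (R : realType) (T : R) (p k : nat) (xi : nat -> R)
    (hT : 0 < T) (hp : (1 <= p)%N) (hnt : (2 <= k + 1)%N)
    (hxi : open_knot_vector (k + 2) p xi)
    (hC0 : spline_space_C0 (k + 2) p xi) :
  let W : 'M[R]_(k + 1) := time_W T p xi (k + 1) in
  let M : 'M[R]_(k + 1) := time_M T p xi (k + 1) in
  let W0 : 'M[R]_k := ulsubmx W in
  let w : 'cV[R]_k := ursubmx W in
  let omega : 'M[R]_1 := drsubmx W in
  let M0 : 'M[R]_k := ulsubmx M in
  let m : 'cV[R]_k := ursubmx M in
  let mu : 'M[R]_1 := drsubmx M in
  let WC := cplx_mx W in
  let MC := cplx_mx M in
  let W0C := cplx_mx W0 in
  let M0C := cplx_mx M0 in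
  [/\ W = block_mx W0 w (- w^T) omega,
      M = block_mx M0 m m^T mu,
      W0^T = - W0
      /\ exists U0 Lambda0 : 'M[R[i]]_k,
           gen_eigendecomposition W0C M0C U0 Lambda0
    & forall U0 Lambda0 : 'M[R[i]]_k,
        gen_eigendecomposition W0C M0C U0 Lambda0 ->
        (exists! v : 'cV[R[i]]_k, M0C *m v = - cplx_mx m) /\
        forall v : 'cV[R[i]]_k, M0C *m v = - cplx_mx m ->
          let v1 : 'cV[R[i]]_(k + 1) := col_mx v 1%:M in
          let q : R[i] := (v1 ^t* *m MC *m v1) ord0 ord0 in
          let rrho : 'cV[R[i]]_(k + 1) := (sqrtC q)^-1 *: v1 in
          let r : 'cV[R[i]]_k := usubmx rrho in
          let rho : 'M[R[i]]_1 := dsubmx rrho in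
          let U : 'M[R[i]]_(k + 1) := block_mx U0 r 0 rho in
          let g : 'cV[R[i]]_k :=
            U0 ^t* *m row_mx W0C (cplx_mx w) *m col_mx r rho in
          let sigma : 'M[R[i]]_1 :=
            row_mx (r ^t*) (rho ^t*) *m WC *m col_mx r rho in
          let Delta : 'M[R[i]]_(k + 1) :=
            block_mx Lambda0 g (- g ^t*) sigma in
          0 < q /\
          [/\ U ^t* *m MC *m U = 1%:M,
              U ^t* *m WC *m U = Delta,
              WC *m U = MC *m U *m Delta,
              arrowhead Delta
            & [/\ U \in unitmx, MC \in unitmx
                & kappa2 U = Num.sqrt (kappa2 MC)]]].
Proof.
move=> W M W0 w omega M0 m mu WC MC W0C M0C.
have m2 : (k + 2 = (k + 1).+1)%N by lia.
rewrite m2 in hxi hC0.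
have MT : M^T = M by exact: time_M_sym hT hxi.
have pM (u : 'cV[R]_(k + 1)) : u != 0 -> 0 < (u^T *m M *m u) 0 0.
  by move=> u0; exact: (time_M_posdef hT hxi hC0 u0).
have skew (i j : 'I_(k + 1)) : (i.+1 < k + 1)%N || (j.+1 < k + 1)%N -> W i j = - W j i.
  by move=> ij; exact: (time_W_skew hT hxi hC0 ij).
(* From here on only symmetry, definiteness and the skewness of [W] off its last diagonal entry
   matter. *)
clearbody W M.
have W0T : W0^T = - W0.
  apply/matrixP => i j; rewrite !mxE; apply: skew => /=.
  by have := ltn_ord i; lia.
have WE : W = block_mx W0 w (- w^T) omega.
  rewrite -[LHS]submxK; congr block_mx; apply/matrixP => i j; rewrite !mxE.
  by apply: skew => /=; have := ltn_ord j; lia.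
have ME : M = block_mx M0 m m^T mu.
  rewrite -[LHS]submxK; congr block_mx; apply/matrixP => i j; rewrite !mxE.
  by rewrite -{1}MT mxE.
have WCE : WC = block_mx W0C (cplx_mx w) (- (cplx_mx w)^t*) (cplx_mx omega).
  by rewrite cplx_mx_trC -map_mxN -map_block_mx -WE.
have MCE : MC = block_mx M0C (cplx_mx m) ((cplx_mx m)^t*) (cplx_mx mu).
  by rewrite cplx_mx_trC -map_block_mx -ME.
have MCT : MC^t* = MC by rewrite cplx_mx_trC MT.
have W0CT : W0C^t* = - W0C by rewrite cplx_mx_trC W0T /cplx_mx map_mxN.
have pMC := cplx_posdef MT pM.
have pM0C : forall z : 'cV[R[i]]_k, z != 0 -> 0 < (z^t* *m M0C *m z) 0 0.
  (* A principal block inherits definiteness: its form at [z] is that of [MC] at [z] padded by 0. *)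
  move=> z z0; have -> : z^t* *m M0C *m z = (col_mx z 0)^t* *m MC *m (col_mx z 0 : 'cV_(k + 1)).
    rewrite tr_col_mx map_row_mx trmx0 map_mx0 MCE mul_row_block !mul0mx !addr0.
    by rewrite mul_row_col mulmx0 addr0.
  apply: pMC; apply: contra z0 => /eqP z0.
  by rewrite -[z](col_mxKu z (0 : 'cV_1)) z0 linear0.
have M0CT : M0C^t* = M0C.
  by move: MCT; rewrite MCE tr_block_mx map_block_mx => /eq_block_mx[].
split=> //.
  split=> //.
  have [U [L [hL LT WU UMU]]] := hermitian_pair_eigendecomposition M0CT pM0C W0CT.
  exists U, L; split=> // i; apply: Re_eq0_conj.
  by move/matrixP: LT => /(_ i i); rewrite !mxE.
move=> U0 L0 [hL _ eW U0M]; split.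
  have uM0 := posdef_unitmx pM0C.
  exists (invmx M0C *m (- cplx_mx m)); split; first by rewrite mulKVmx.
  by move=> v <-; rewrite mulKmx.
move=> v ev v1 q rrho r rho U g sigma Delta.
(* [v1] is nonzero because its last entry is 1. *)
have q0 : 0 < q.
  apply: pMC; apply/negP => /eqP /(congr1 (@dsubmx _ _ _ _)); rewrite col_mxKd linear0.
  by move=> /matrixP /(_ 0 0); rewrite !mxE => /eqP; rewrite oner_eq0.
have [UMU UWU] := bordered_congruence MCE WCE MCT W0CT eW U0M ev q0.
have uMU : (U^t* *m MC) *m U = 1%:M by exact: UMU.
split=> //; split=> //.
- exact: congruence_eigen.
- move=> i j ij ik jk.
  have -> : i = lshift 1 (Ordinal ik) by exact: val_inj.
  have -> : j = lshift 1 (Ordinal jk) by exact: val_inj.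
  by rewrite block_mxEul; move/is_diag_mxP: hL; apply.
- split.
  + by have [_] := mulmx1_unit uMU.
  + exact: posdef_unitmx pMC.
  + by apply: kappa2_congruence => //; rewrite addn1.
Qed.
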